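(* (a) If $p_k>1$ for all $k$, then $[l(r,s,t,p;B)]^\gamma=\Gamma_5(p)$; and if $0<p_k\le1$ for all $k$, then $[l(r,s,t,p;B)]^\gamma=\Gamma_4(p)$. (b) For $0<p_k\le H<\infty$: (i) $[c_0(r,s,t,p;B)]^\gamma=\Gamma_1(p)$; (ii) $[c(r,s,t,p;B)]^\gamma=\Gamma_1(p)\cap\Gamma_2(p)$; (iii) $[l_\infty(r,s,t,p;B)]^\gamma=\Gamma_3(p)$. Here $$\Gamma_1(p)=\bigcup_{L\in\mathbb{N}}\Big\{a\in w:\sup_n\sum_k|e_{nk}|L^{-1/p_k}<\infty\Big\},\quad \Gamma_2(p)=\Big\{a\in w:\sup_n\Big|\sum_ke_{nk}\Big|<\infty\Big\},$$ $$\Gamma_3(p)=\bigcap_{L\in\mathbb{N}}\Big\{a\in w:\sup_n\sum_k|e_{nk}|L^{1/p_k}<\infty\Big\},\quad \Gamma_4(p)=\bigcup_{L\in\mathbb{N}}\Big\{a\in w:\sup_n\sup_k|e_{nk}L^{-1}|^{p_k}<\infty\Big\},$$ $$\Gamma_5(p)=\bigcup_{L\in\mathbb{N}}\Big\{a\in w:\sup_n\sum_k|e_{nk}L^{-1}|^{p_k'}<\infty\Big\},$$ where $p_k'=p_k/(p_k-1)$ (used when $p_k>1$) and, for $a=(a_k)\in w$, the matrix $E=(e_{nk})$ is defined by $e_{nk}=0$ for $k>n$ and, for $0\le k\le n$, $$e_{nk}=r_k\Big[\frac1u\frac{a_k}{s_0t_k}+\sum_{j=k}^{k+1}(-1)^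{j-k}\frac{D^{(s)}_{j-k}}{t_j}\Big(\sum_{l=k+1}^{n}\frac{(-v)^{l-j}}{u^{l-j+1}}a_l\Big)+\sum_{j=k+2}^{n}(-1)^{j-k}\frac{D^{(s)}_{j-k}}{t_j}\Big(\sum_{l=j}^{n}\frac{(-v)^{l-j}}{u^{l-j+1}}a_l\Big)\Big].$$
   Context: Sequences are indexed by $\mathbb{N}_0=\{0,1,2,\dots\}$; $\mathbb{N}=\{1,2,\dots\}$; empty sums are $0$; $w$ is the space of all real or complex sequences. $p=(p_k)$ is a bounded sequence of strictly positive real numbers, $H=\sup_k p_k$. The spaces of Maddox are $l_\infty(p)=\{x\in w:\sup_k|x_k|^{p_k}<\infty\}$, $c(p)=\{x\in w:\lim_k|x_k-l|^{p_k}=0\text{ for some }l\in\mathbb{C}\}$, $c_0(p)=\{x\in w:\lim_k|x_k|^{p_k}=0\}$, $l(p)=\{x\in w:\sum_k|x_k|^{p_k}<\infty\}$. $r=(r_n)$, $t=(t_n)$, $s=(s_n)$ are sequences in $w$ with $r_n\ne0$ and $t_n\neq 0$ for all $n$, and $s_0\neq0$; $u,v$ are nonzero scalars. $A(r,s,t)$ is the lower triangular infinite matrix with entries $s_{n-k}t_k/r_n$ for $0\le k\le n$ and $0$ for $k>n$. $B=B(u,v)=(b_{nk})$ is the matrix with $b_{nn}=u$, $b_{n,n-1}=v$ and all other entries $0$. $A(r,s,t;B)=A(r,s,t)\cdot B$ is the matrix product. For $X\in\{l_\infty(p),c(p),c_0(p),l(p)\}$, $X(r,s,t,p;B)=\{x\in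 w:A(r,s,t;B)x\in X\}$, written $l_\infty(r,s,t,p;B)$, $c(r,s,t,p;B)$, $c_0(r,s,t,p;B)$, $l(r,s,t,p;B)$ respectively. $D^{(s)}_0=1/s_0$ and, for $n\ge1$, $D^{(s)}_n=s_0^{-(n+1)}\det(d_{ij})_{1\le i,j\le n}$ with $d_{ij}=s_{i-j+1}$ if $j\le i+1$ and $d_{ij}=0$ if $j>i+1$. The $\gamma$-dual of $U\subset w$ is $U^\gamma=\{a\in w:(a_nx_n)_n\in bs\text{ for all }x\in U\}$, where $bs$ is the space of sequences whose series has bounded partial sums. *)

(* Defs.v *)
From HB Require Import structures.
From mathcomp Require Import all_boot all_order all_algebra.
From mathcomp Require Import all_classical all_reals all_analysis.
From mathcomp Require Import complex.

Set Implicit Arguments.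
Unset Strict Implicit.
Unset Printing Implicit Defensive.

Import Order.TTheory GRing.Theory Num.Theory.
Import numFieldNormedType.Exports.

Local Open Scope classical_set_scope.
Local Open Scope ring_scope.

(* Sequences are either all real or all complex; both cases are covered by
   quantifying over [scalar_kind].  The library norm of [R[i]] takes its values
   in [R[i]], whence a separate real-valued [modulus]. *)
Inductive scalar_kind := real_scalars | complex_scalars.

Definition scalar_field (R : realType) (F : scalar_kind) : numFieldType :=
  match F with
  | real_scalars => R
  | complex_scalars => R[i]
  end.

Definition modulus (R : realType) (F : scalar_kind) : scalar_field R F -> R :=
  match F return scalar_field R F -> R with
  | real_scalars => fun x : R => `|x|
  | complex_scalars => fun x : R[i] => Normc.normc x
  end.
Arguments modulus {R F} x.

Section Spaces.
Context {R : realType} {F : scalar_kind}.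
Local Notation K := (scalar_field R F).

Implicit Types (p : nat -> R) (x a r s t : nat -> K) (A B : nat -> nat -> K).

Definition fin_sup (f : nat -> R) : Prop :=
  (ereal_sup (range (fun k => (f k)%:E)) < +oo)%E.

Definition linf p : set (nat -> K) :=
  [set x | fin_sup (fun k => modulus (x k) `^ p k)].

Definition cp p : set (nat -> K) :=
  [set x | exists l : K, modulus (x k - l) `^ p k @[k --> \oo] --> (0 : R)].

Definition c0p p : set (nat -> K) :=
  [set x | modulus (x k) `^ p k @[k --> \oo] --> (0 : R)].

Definition lp p : set (nat -> K) :=
  [set x | (\sum_(0 <= k <oo) (modulus (x k) `^ p k)%:E < +oo)%E].

Definition bs : set (nat -> K) :=
  [set x | fin_sup (fun n => modulus (series x n))].

Definition gamma_dual (U : set (nat -> K)) : set (nat -> K) :=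
  [set a | forall x, U x -> bs (fun n => a n * x n)].

(* Infinite sum; [lim] is total, but every matrix below has finitely supported
   rows, so that these series all converge. *)
Definition infsum x : K := limn (series x).

Definition imx_mul A B : nat -> nat -> K :=
  fun n k => infsum (fun j => A n j * B j k).

Definition imx_app A x : nat -> K := fun n => infsum (fun k => A n k * x k).

Definition matA r s t : nat -> nat -> K :=
  fun n k => if (k <= n)%N then s (n - k)%N * t k / r n else 0.

Definition matB (u v : K) : nat -> nat -> K :=
  fun n k => if k == n then u else if k.+1 == n then v else 0.

Definition matAB r s t (u v : K) : nat -> nat -> K :=
  imx_mul (matA r s t) (matB u v).

(* X(r, s, t, p; B), with X standing for one of the Maddox spaces of [p]. *)
Definition mx_domain (X : set (nat -> K)) r s t (u v : K) : set (nat -> K) :=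
  [set x | X (imx_app (matAB r s t u v) x)].

(* Indices are shifted by one with respect to 1 <= i, j <= n, which leaves
   i - j + 1 unchanged; the empty determinant is 1, so [Dcoef s 0] is 1 / s_0. *)
Definition Dcoef s (n : nat) : K :=
  (s 0%N ^+ n.+1)^-1 *
  \det (\matrix_(i < n, j < n)
          (if (j <= i.+1)%N then s (i.+1 - j)%N else 0)).

Definition matE r s t (u v : K) a : nat -> nat -> K := fun n k =>
  if (k <= n)%N then
    r k * (u^-1 * (a k / (s 0%N * t k))
      + \sum_(k <= j < k.+2) (-1) ^+ (j - k) * (Dcoef s (j - k) / t j) *
          (\sum_(k.+1 <= l < n.+1) (- v) ^+ (l - j) / u ^+ (l - j).+1 * a l)
      + \sum_(k.+2 <= j < n.+1) (-1) ^+ (j - k) * (Dcoef s (j - k) / t j) *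
          (\sum_(j <= l < n.+1) (- v) ^+ (l - j) / u ^+ (l - j).+1 * a l))
  else 0.

Definition fin_sup_sum (f : nat -> nat -> R) : Prop :=
  (ereal_sup (range (fun n => \sum_(0 <= k <oo) (f n k)%:E)) < +oo)%E.

Definition Gamma1 r s t u v p : set (nat -> K) :=
  \bigcup_(L in [set L : nat | (0 < L)%N])
    [set a | fin_sup_sum (fun n k =>
       modulus (matE r s t u v a n k) * L%:R `^ (- (1 / p k)))].

Definition Gamma2 r s t u v : set (nat -> K) :=
  [set a | fin_sup (fun n => modulus (infsum (matE r s t u v a n)))].

Definition Gamma3 r s t u v p : set (nat -> K) :=
  \bigcap_(L in [set L : nat | (0 < L)%N])
    [set a | fin_sup_sum (fun n k =>
       modulus (matE r s t u v a n k) * L%:R `^ (1 / p k))].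

Definition Gamma4 r s t u v p : set (nat -> K) :=
  \bigcup_(L in [set L : nat | (0 < L)%N])
    [set a | (ereal_sup (range (fun n => ereal_sup (range (fun k =>
       (modulus (matE r s t u v a n k * L%:R^-1) `^ p k)%:E)))) < +oo)%E].

Definition Gamma5 r s t u v p : set (nat -> K) :=
  \bigcup_(L in [set L : nat | (0 < L)%N])
    [set a | fin_sup_sum (fun n k =>
       modulus (matE r s t u v a n k * L%:R^-1) `^ (p k / (p k - 1)))].

End Spaces.

(* Main.v *)
Require Import Defs.
From mathcomp Require Import all_boot all_order all_algebra.
From mathcomp Require Import all_classical all_reals all_analysis.
From mathcomp Require Import complex ring lra zify.

(** The matrix [A(r,s,t;B)] is a product of diagonal matrices and of two lower
    triangular Toeplitz matrices, whose symbols are [s] and [(u, v, 0, ...)].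
    Multiplying by a Toeplitz matrix is convolving with its symbol, and both
    symbols have convolution inverses: [m |-> (-1)^m D_m], by Cramer's rule, and
    [m |-> (-v)^m / u^(m+1)].  Hence [x |-> y = A(r,s,t;B) x] is a bijection of
    the space of all sequences, and substituting its inverse turns the partial
    sum [sum_(l <= n) a_l x_l] into the [n]-th entry of [E y], where [E] is the
    matrix attached to [a] in the statement ([sum_solution]).  So [a] lies in
    the gamma-dual of the domain of [X] if and only if [E] maps every [y] in [X]
    to a bounded sequence ([gamma_dual_mx_domain]), and what remains is to
    characterize, for each Maddox space [X], the lower triangular matrices with
    this property.

    The sufficiency of each condition is an elementary estimate (Young's
    inequality when [p_k > 1]).  Necessity rests on a uniform boundedness
    principle, [gliding_hump]: if [E y] is bounded for every [y] in [c_0(p)] or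
    [l(p)], then the entries of [E y] are bounded by one constant for all [y] in
    a small ball [sup_k |y_k|^(p_k) <= d], resp. [sum_k |y_k|^(p_k) <= d].
    Testing this bound on a well chosen [y] of the ball, with arguments aligned
    so that no cancellation occurs in the [n]-th row, gives the condition:
    - for [c_0(p)], take [|y_k| = L^(-1/p_k)] with [1/L <= d];
    - for [l(p)] with [p_k <= 1], take one nonzero coordinate [d^(1/p_k)];
    - for [l(p)] with [p_k > 1], take the equality case of Young's inequality,
      [|y_k| = theta |e_nk / L|^(p_k' - 1)].
    The space [c(p)] is [c_0(p)] plus the constant sequences, and [l_oo(p)]
    reduces to [c_0]: it contains [(L^(1/p_k) z_k)] for every null sequence [z],
    so the matrix [(e_nk L^(1/p_k))] maps [c_0] to bounded sequences. *)

Set Implicit Arguments.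
Unset Strict Implicit.
Unset Printing Implicit Defensive.

Import Order.TTheory GRing.Theory Num.Theory.
Import numFieldNormedType.Exports.

Local Open Scope classical_set_scope.
Local Open Scope ring_scope.

(** * Modulus and arguments of scalars *)

Section Modulus.
Context {R : realType} {F : scalar_kind}.
Local Notation K := (scalar_field R F).
Implicit Types x y z : K.

Lemma modulus_ge0 x : 0 <= modulus x.
Proof.
by case: F x => [x|[a b]]; [exact: normr_ge0 | rewrite /= sqrtr_ge0].
Qed.

Lemma modulus0 : modulus (0 : K) = 0.
Proof. by case: F; [exact: normr0 | exact: Normc.normc0]. Qed.

Lemma modulusM x y : modulus (x * y) = modulus x * modulus y.
Proof. by case: F x y => x y; [exact: normrM | exact: Normc.normcM]. Qed.

Lemma modulusD x y : modulus (x + y) <= modulus x + modulus y.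
Proof. by case: F x y => x y; [exact: ler_normD | exact: le_normcD]. Qed.

Lemma modulusN x : modulus (- x) = modulus x.
Proof. by case: F x => x; [exact: normrN | exact: normcN]. Qed.

Lemma modulusV x : modulus x^-1 = (modulus x)^-1.
Proof. by case: F x => x; [exact: normfV | exact: Normc.normcV]. Qed.

Lemma modulus_nat n : modulus (n%:R : K) = n%:R.
Proof.
case: F; first exact: normr_nat.
by rewrite /modulus -[n%:R]/(1 *+ n : R[i]) normcMn Normc.normc1.
Qed.

Lemma modulus_sum I (s : seq I) (P : pred I) (f : I -> K) :
  modulus (\sum_(i <- s | P i) f i) <= \sum_(i <- s | P i) modulus (f i).
Proof.
elim/big_rec2: _ => [|i y1 y2 _ h]; first by rewrite modulus0.
by apply: (le_trans (modulusD _ _)); rewrite lerD2l.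
Qed.

Definition ofreal : R -> K :=
  match F return R -> scalar_field R F with
  | real_scalars => fun a => a
  | complex_scalars => fun a => (a%:C)%C
  end.

Lemma modulus_ofreal a : 0 <= a -> modulus (ofreal a) = a.
Proof.
rewrite /ofreal; case: F => /= a0; first by rewrite ger0_norm.
by rewrite expr0n /= addr0 sqrtr_sqr ger0_norm.
Qed.

Lemma ofrealM a b : ofreal (a * b) = ofreal a * ofreal b.
Proof. by rewrite /ofreal; case: F => //; rewrite rmorphM. Qed.

Lemma ofreal_sum n (f : nat -> R) :
  ofreal (\sum_(k < n) f k) = \sum_(k < n) ofreal (f k).
Proof. by rewrite /ofreal; case: F => //; rewrite rmorph_sum. Qed.

Lemma phase x : exists2 w, modulus w = 1 & x * w = ofreal (modulus x).
Proof.
rewrite /ofreal; case: F x => x.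
  exists (if 0 <= x then 1 else -1).
    by rewrite /=; case: ifP => _; rewrite ?normrN normr1.
  rewrite /=; case: lerP => h; rewrite ?mulr1 ?mulrN1.
    by rewrite ger0_norm.
  by rewrite ltr0_norm.
have [->|x0] := eqVneq x 0.
  exists (1 : R[i]); first exact: Normc.normc1.
  by rewrite mul0r /= expr0n addr0 sqrtr0.
have m0 : Normc.normc x != 0 by apply: contra_neq x0 => /Normc.eq0_normc.
exists ((Normc.normc x)%:C%C / x) => /=.
  rewrite -[LHS]/(Normc.normc ((Normc.normc x)%:C%C / x)) Normc.normcM Normc.normcV.
  rewrite /= expr0n /= addr0 sqrtr_sqr ger0_norm ?divff //.
  by case: (x) => a b; apply: sqrtr_ge0.
by rewrite mulrC mulfVK.
Qed.

(** Rotating each [y k] by the opposite of the argument of [e k] makes every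
    term of the sum a nonnegative real, so that nothing cancels. *)
Lemma exists_aligned (c : nat -> R) (e : nat -> K) : (forall k, 0 <= c k) ->
  exists2 y : nat -> K, (forall k, modulus (y k) = c k) &
    forall n, modulus (\sum_(k < n) e k * y k) = \sum_(k < n) modulus (e k) * c k.
Proof.
move=> c0.
have /choice[w hw] k : exists w, modulus w = 1 /\ e k * w = ofreal (modulus (e k)).
  by have [w] := phase (e k); exists w.
exists (fun k => ofreal (c k) * w k) => [k|n].
  by rewrite modulusM modulus_ofreal // (hw k).1 mulr1.
under eq_bigr => k _ do rewrite mulrCA (hw k).2 -ofrealM mulrC.
rewrite -(ofreal_sum n (fun k => modulus (e k) * c k)) modulus_ofreal //.
by apply: sumr_ge0 => k _; rewrite mulr_ge0 // modulus_ge0.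
Qed.

End Modulus.

(** * Finiteness of suprema and series of nonnegative terms *)

Section Extended.
Context {R : realType}.
Implicit Types f : nat -> R.

Lemma fin_supP f : (forall k, 0 <= f k) ->
  fin_sup f <-> exists M, forall k, f k <= M.
Proof.
move=> f0; rewrite /fin_sup; split=> [h|[M hM]].
  have h' k : ((f k)%:E <= ereal_sup (range (fun k => (f k)%:E)))%E.
    by apply: ereal_sup_ubound; exists k.
  move: h h'; case: (ereal_sup _) => [M _ h|//|_ h].
    by exists M => k; rewrite -lee_fin.
  by have := h 0%N; rewrite leNgt ltNyr.
apply: (@le_lt_trans _ _ M%:E); last exact: ltry.
by apply: ge_ereal_sup => _ [k _ <-]; rewrite lee_fin.
Qed.

Lemma ereal_sup_sup_finP (f : nat -> nat -> R) : (forall n k, 0 <= f n k) ->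
  ((ereal_sup (range (fun n => ereal_sup (range (fun k => (f n k)%:E))))
    < +oo)%E <->
   exists M, forall n k, f n k <= M).
Proof.
move=> f0; split=> [h|[M hM]]; last first.
  apply: (@le_lt_trans _ _ M%:E); last exact: ltry.
  apply: ge_ereal_sup => _ [n _ <-].
  by apply: ge_ereal_sup => _ [k _ <-]; rewrite lee_fin.
have h' n k : ((f n k)%:E <=
    ereal_sup (range (fun n => ereal_sup (range (fun k => (f n k)%:E)))))%E.
  apply: (@le_trans _ _ (ereal_sup (range (fun k => (f n k)%:E)))).
    by apply: ereal_sup_ubound; exists k.
  by apply: ereal_sup_ubound; exists n.
move: h h'; case: (ereal_sup _) => [M _ h|//|_ h].
  by exists M => n k; rewrite -lee_fin.
by have := h 0%N 0%N; rewrite leNgt ltNyr.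
Qed.

Lemma eseries_lt_pinftyP f : (forall k, 0 <= f k) ->
  ((\sum_(0 <= k <oo) (f k)%:E < +oo)%E <->
   exists M, forall n, \sum_(k < n) f k <= M).
Proof.
move=> f0; split=> [h|[M hM]].
  have h' n : ((\sum_(k < n) f k)%:E <= \sum_(0 <= k <oo) (f k)%:E)%E.
    rewrite -sumEFin -(big_mkord xpredT (fun k => (f k)%:E)).
    by apply: nneseries_lim_ge => k _ _; rewrite lee_fin.
  move: h h'; case: (limn _) => [M _ h|//|_ h].
    by exists M => n; rewrite -lee_fin.
  by have := h 0%N; rewrite leNgt ltNyr.
apply: (@le_lt_trans _ _ M%:E); last exact: ltry.
apply: lime_le; first by apply: is_cvg_nneseries => k _ _; rewrite lee_fin.
by apply: nearW => n; rewrite big_mkord sumEFin lee_fin.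
Qed.

Lemma eseries_finite f n : (forall k, (n <= k)%N -> f k = 0) ->
  (\sum_(0 <= k <oo) (f k)%:E = (\sum_(k < n) f k)%:E)%E.
Proof.
move=> f0; apply: cvg_lim => //; apply: cvg_near_cst.
exists n => //= m nm; rewrite (big_cat_nat _ nm) //= [X in (_ + X)%E]big_nat_cond.
rewrite [X in (_ + X)%E]big1 ?addr0 ?big_mkord ?sumEFin // => k /andP[/andP[nk _] _].
by rewrite f0.
Qed.

Lemma fin_sup_sumP (f : nat -> nat -> R) :
  (forall n k, 0 <= f n k) -> (forall n k, (n < k)%N -> f n k = 0) ->
  fin_sup_sum f <-> exists M, forall n, \sum_(k < n.+1) f n k <= M.
Proof.
move=> f0 fT; rewrite -fin_supP => [|n]; last by apply: sumr_ge0.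
rewrite /fin_sup_sum /fin_sup.
suff -> : (fun n => \sum_(0 <= k <oo) (f n k)%:E)%E =
  (fun n => (\sum_(k < n.+1) f n k)%:E)%E by [].
by apply/funext => n; apply: eseries_finite => k; apply: fT.
Qed.

(** Finitely many terms do not affect boundedness. *)
Lemma bounded_natl f M n : (forall k, (n <= k)%N -> f k <= M) ->
  exists M', forall k, f k <= M'.
Proof.
move=> hM; exists (M + \sum_(k < n) `|f k - M|) => k; case: (ltnP k n) => kn.
  rewrite (bigD1 (Ordinal kn)) //= addrA.
  by apply: ler_wpDr; rewrite ?sumr_ge0 // -lerBlDl ler_norm.
by apply: ler_wpDr; rewrite ?sumr_ge0 ?hM.
Qed.

End Extended.

Lemma infsum_finite (R : realType) (F : scalar_kind) (x : nat -> scalar_field R F) n :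
  (forall k, (n <= k)%N -> x k = 0) -> infsum x = \sum_(k < n) x k.
Proof.
move=> x0; apply: lim_near_cst; first exact: norm_hausdorff.
exists n => //= m nm; rewrite /series /= (big_cat_nat _ nm) //= [X in _ + X]big_nat_cond.
rewrite [X in _ + X]big1 ?addr0 ?big_mkord // => k /andP[/andP[nk _] _].
by rewrite x0.
Qed.

(** * Uniform boundedness for row-finite matrices *)

Section GlidingHump.
Context {R : realType} {F : scalar_kind}.
Local Notation K := (scalar_field R F).
Implicit Types (y : nat -> K) (E : nat -> nat -> K) (Q : R -> set (nat -> K)).

Definition lower_triangular E := forall n k, (n < k)%N -> E n k = 0.

Definition rowsum E y n : K := \sum_(k < n.+1) E n k * y k.

Definition bounded_rows E y := exists M, forall n, modulus (rowsum E y n) <= M.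

Definition splice N y y' : nat -> K := fun k => if (k < N)%N then y k else y' k.

Definition truncation N y := splice N y (fun=> 0).

Lemma rowsum_ext E y y' n : (forall k, (k <= n)%N -> y k = y' k) ->
  rowsum E y n = rowsum E y' n.
Proof. by move=> h; apply: eq_bigr => k _; rewrite h // -ltnS. Qed.

Lemma rowsum_truncation E y N n : lower_triangular E ->
  rowsum E (truncation N y) n = \sum_(k < N) E n k * y k.
Proof.
move=> hE; rewrite /rowsum.
rewrite -(@infsum_finite _ _ (fun k => E n k * truncation N y k)); last first.
  by move=> k nk; rewrite hE // mul0r.
rewrite (@infsum_finite _ _ _ N) => [|k Nk].
  by apply: eq_bigr => k _; rewrite /truncation /splice ltn_ord.
by rewrite /truncation /splice ltnNge Nk mulr0.
Qed.

Lemma rowsum_splice E y y' N n :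
  rowsum E (splice N y y') n =
  rowsum E (truncation N y) n + rowsum E y' n - rowsum E (truncation N y') n.
Proof.
rewrite /rowsum -big_split -sumrB; apply: eq_bigr => k _ /=.
rewrite /truncation /splice -mulrDr -mulrBr.
by case: ifP => _; rewrite ?addrK ?add0r ?subr0.
Qed.

Lemma modulus_rowsum E y n :
  modulus (rowsum E y n) <= \sum_(k < n.+1) modulus (E n k) * modulus (y k).
Proof.
by apply: (le_trans (modulus_sum _ _ _)); under eq_bigr do rewrite modulusM.
Qed.

(** The unit sequences are truncations, and they pick out the columns. *)
Lemma column_bounded E k : lower_triangular E ->
  (forall N y, bounded_rows E (truncation N y)) ->
  exists C, forall n, modulus (E n k) <= C.
Proof.
move=> hE /(_ k.+1 (fun j => (j == k)%:R)) [C hC]; exists C => n.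
rewrite (le_trans _ (hC n)) // rowsum_truncation // big_ord_recr /= eqxx mulr1.
rewrite big1 ?add0r // => j _.
rewrite (_ : (j : nat) == k = false) ?mulr0 //.
by apply/negbTE; rewrite neq_ltn ltn_ord.
Qed.

Lemma truncation_bounded E N : lower_triangular E ->
  (forall N y, bounded_rows E (truncation N y)) ->
  exists C, forall y, (forall k, modulus (y k) <= 1) ->
    forall n, modulus (rowsum E (truncation N y) n) <= C.
Proof.
move=> hE hb.
have /choice[c hc] k := column_bounded k hE hb.
exists (\sum_(k < N) c k) => y y1 n; rewrite rowsum_truncation //.
apply: (le_trans (modulus_sum _ _ _)); apply: ler_sum => k _.
by rewrite modulusM -[c k]mulr1 ler_pM ?modulus_ge0.
Qed.

(** One hump.  Coordinates below [N] contribute boundedly to all rows, both for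
    the fixed [y] and, columns being bounded, for all [x] of the ball [Q d]; an
    [x] and a row [n] for which the value is huge therefore still give a large
    value after the coordinates of [x] below [N] are replaced by those of [y].
    This forces [N <= n], since shorter rows only see these coordinates. *)
Lemma gliding_hump_step Q E (d : R) y N i : lower_triangular E ->
  (forall N y, bounded_rows E (truncation N y)) ->
  (forall x, Q d x -> forall k, modulus (x k) <= 1) ->
  (forall C, exists x n, Q d x /\ C < modulus (rowsum E x n)) ->
  exists nx : nat * (nat -> K), [/\ (N <= nx.1)%N, Q d nx.2 &
    i%:R < modulus (rowsum E (splice N y nx.2) nx.1)].
Proof.
move=> hE hb Q1 unb.
have [C1 hC1] := hb N y; have [C2 hC2] := truncation_bounded N hE hb.
have [x [n [Qx hx]]] := unb (i%:R + C1 + C2).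
have C10 : 0 <= C1 := le_trans (modulus_ge0 _) (hC1 0%N).
have i0 : 0 <= i%:R :> R by [].
have h2 := hC2 _ (Q1 _ Qx) n; have h1 := hC1 n.
exists (n, x); split=> //=.
  rewrite leqNgt; apply/negP => nN; move: hx.
  rewrite (@rowsum_ext _ x (truncation N x)) => [|k kn]; first by lra.
  by rewrite /truncation /splice (leq_ltn_trans kn nN).
rewrite rowsum_splice.
set a := rowsum E (truncation N y) n in h1 *; set b := rowsum E x n in hx *.
set c := rowsum E (truncation N x) n in h2 *.
have : b = (a + b - c) + (c - a) by ring.
move=> /(congr1 modulus) eb; have := modulusD (a + b - c) (c - a).
have := modulusD c (- a); rewrite modulusN -eb; lra.
Qed.

(** Think of [Q d] as the ball of radius [d] of [X].  If the rows of [E] were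
    unbounded on every ball, humps of size [2^-i] could be placed one after the
    other on disjoint blocks of coordinates, each one starting beyond the row on
    which the previous one is large.  This row, being finite, does not see the
    later humps, so the sequence glued from the humps, which lies in [X] by the
    fourth hypothesis, has an unbounded image under [E]. *)
Lemma gliding_hump (X : set (nat -> K)) Q E : lower_triangular E ->
  (forall N y, X (truncation N y)) ->
  (forall d y, d <= 1 -> Q d y -> forall k, modulus (y k) <= 1) ->
  (forall y (N : nat -> nat), N 0%N = 0%N -> (forall i, (N i < N i.+1)%N) ->
    (forall i, exists2 x, Q (2^-1 ^+ i) x &
       forall k, (N i <= k < N i.+1)%N -> y k = x k) -> X y) ->
  (forall y, X y -> bounded_rows E y) ->
  exists d C, 0 < d /\
    forall y, Q d y -> forall n, modulus (rowsum E y n) <= C.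
Proof.
move=> hE Xtrunc Q1 Xglue Xb; apply: contrapT => unb.
have half1 i : 2^-1 ^+ i <= 1 :> R by rewrite exprn_ile1 // ?invr_ge0 ?invf_le1 ?ler1n.
have {}unb i C : exists x n, Q (2^-1 ^+ i) x /\ C < modulus (rowsum E x n).
  apply: contrapT => h; apply: unb; exists (2^-1 ^+ i), C; split.
    by rewrite exprn_gt0 // invr_gt0.
  move=> x Qx n; rewrite leNgt; apply/negP => hC; apply: h.
  by exists x, n.
have /choice[f hf] (a : nat * ((nat -> K) * nat)) := gliding_hump_step a.2.1 a.2.2 a.1
  hE (fun N y => Xb _ (Xtrunc N y)) (Q1 _ ^~ (half1 a.1)) (unb a.1).
(* The state after [i] steps: the sequence built so far and the index below
   which it is final. *)
pose st i := iteri i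
  (fun i yN => (splice yN.2 yN.1 (f (i, yN)).2, (f (i, yN)).1.+1))
  ((fun=> 0) : nat -> K, 0%N).
pose N i := (st i).2.
have Nlt i : (N i < N i.+1)%N.
  by rewrite /N /= ltnS; have [] := hf (i, st i).
have leN i : (i <= N i)%N by elim: i => // i ih; apply: leq_ltn_trans (Nlt i).
have Nle i j : (i <= j)%N -> (N i <= N j)%N.
  by apply: (homo_leq leqnn (fun _ _ _ => @leq_trans _ _ _)) => n; exact: ltnW.
have stable k i j : (i <= j)%N -> (k < N i)%N -> (st j).1 k = (st i).1 k.
  elim: j => [|j ih]; first by rewrite leqn0 => /eqP->.
  rewrite leq_eqVlt => /predU1P[-> //|ij kN].
  have kNj : (k < N j)%N by apply: (leq_trans kN); exact: Nle.
  by rewrite -ih //= /splice -/(N j) kNj.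
pose y k := (st k.+1).1 k.
have yE i k : (k < N i)%N -> y k = (st i).1 k.
  move=> kN; case: (leqP i k.+1) => h; first exact: stable.
  by rewrite /y -(@stable k k.+1 i) // ltnW.
have [M hM] : bounded_rows E y.
  apply/Xb/(Xglue y N) => // i; exists (f (i, st i)).2.
    by have [] := hf (i, st i).
  move=> k /andP[Nk kN]; rewrite (yE i.+1) //= /splice.
  by rewrite -/(N i) ltnNge Nk.
pose i := (Num.truncn M).+1.
have [_ _ /= hi] := hf (i, st i).
have := hM (f (i, st i)).1; rewrite (@rowsum_ext _ y (st i.+1).1) => [h|k kn].
  have := lt_le_trans hi h; rewrite ltNge => /negP; apply.
  by rewrite ltW // truncnS_gt.
by apply: yE; rewrite /N /= ltnS.
Qed.

End GlidingHump.

(** * Real powers and dyadic blocks *)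

Section Powers.
Context {R : realType}.
Implicit Types a b q : R.

Lemma one_powR q : 1 `^ q = 1 :> R.
Proof. by rewrite powR1. Qed.

Lemma powRVK a q : 0 < q -> 0 <= a -> (a `^ q^-1) `^ q = a.
Proof. by move=> q0 a0; rewrite -powRrM mulVf ?powRr1 // gt_eqF. Qed.

Lemma powRKV a q : 0 < q -> 0 <= a -> (a `^ q) `^ q^-1 = a.
Proof. by move=> q0 a0; rewrite -powRrM mulfV ?powRr1 // gt_eqF. Qed.

Lemma ler_powRV a b q : 0 < q -> 0 <= a -> a `^ q <= b -> a <= b `^ q^-1.
Proof.
move=> q0 a0 ab; rewrite -[leLHS](powRKV q0 a0).
have b0 : 0 <= b := le_trans (powR_ge0 _ _) ab.
by apply: ge0_ler_powR; rewrite ?invr_ge0 ?nnegrE ?powR_ge0 // ltW.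
Qed.

Lemma powR_le1 a q : 0 < q -> 0 <= a -> a `^ q <= 1 -> a <= 1.
Proof. by move=> q0 a0 /(ler_powRV q0 a0); rewrite powR1. Qed.

Lemma ge0_powR_ler1 a q : 0 <= a -> a <= 1 -> 0 < q -> q <= 1 -> a <= a `^ q.
Proof.
move=> a0 a1 q0 q1; have [->|an0] := eqVneq a 0; first by rewrite powR_ge0.
have a_gt0 : 0 < a by rewrite lt_neqAle eq_sym an0.
rewrite -[leLHS]powRr1 // -subr_ge0.
have -> : a `^ 1 = a `^ q * a `^ (1 - q).
  by rewrite -powRD ?an0 ?implybT // addrC subrK.
rewrite -[X in X - _]mulr1 -mulrBr mulr_ge0 ?powR_ge0 // subr_ge0.
rewrite -[leRHS](one_powR (1 - q)).
by apply: ge0_ler_powR; rewrite ?nnegrE ?subr_ge0.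
Qed.

Lemma powR_ler_ge1 a q : 0 <= a -> a <= 1 -> 1 <= q -> a `^ q <= a.
Proof.
move=> a0 a1 q1; have q0 : 0 < q := lt_le_trans ltr01 q1.
rewrite -[leRHS](powRKV q0 a0); apply: ge0_powR_ler1.
- exact: powR_ge0.
- rewrite -[1](one_powR q); apply: ge0_ler_powR; rewrite ?nnegrE //; exact: ltW.
- by rewrite invr_gt0.
- by rewrite invf_le1.
Qed.

Lemma sum_finite_le (f : nat -> R) n m :
  (forall k, 0 <= f k) -> (forall k, (n <= k)%N -> f k = 0) ->
  \sum_(k < m) f k <= \sum_(k < n) f k.
Proof.
move=> f0 fn; rewrite -lee_fin -(eseries_finite fn) -sumEFin.
rewrite -(big_mkord xpredT (fun k => (f k)%:E)).
by apply: nneseries_lim_ge => k _ _; rewrite lee_fin.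
Qed.

Lemma exists_half_lt (e : R) : 0 < e -> exists i, 2^-1 ^+ i <= e.
Proof.
move=> e0; exists (Num.truncn e^-1).+1.
rewrite exprVn -[leRHS]invrK lef_pV2 ?posrE ?exprn_gt0 ?invr_gt0 //.
apply/ltW/(lt_trans (truncnS_gt _)); rewrite -natrX ltr_nat; exact: ltn_expl.
Qed.

End Powers.

Lemma block_index (N : nat -> nat) : N 0%N = 0%N -> (forall i, (N i < N i.+1)%N) ->
  forall k, exists j, (N j <= k < N j.+1)%N.
Proof.
move=> N0 Nlt k.
have leN i : (i <= N i)%N by elim: i => // i ih; apply: leq_ltn_trans (Nlt i).
have [m] : exists m, (k < N m)%N by exists k.+1; apply: leN.
elim: m => [|i ih]; first by rewrite N0.
case: (leqP (N i) k) => [h h'|/ih h _ //].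
by exists i; rewrite h.
Qed.

(** * Matrix maps from the Maddox spaces to bounded sequences *)

Section Maddox.
Context {R : realType} {F : scalar_kind}.
Local Notation K := (scalar_field R F).
Variables (p : nat -> R) (E : nat -> nat -> K).
Hypotheses (p_gt0 : forall k, 0 < p k) (hE : lower_triangular E).
Implicit Types y : nat -> K.

Lemma powRp0 k : 0 `^ p k = 0 :> R.
Proof. by rewrite powR0 // gt_eqF. Qed.

Lemma c0p_local_bound : (forall y, c0p p y -> bounded_rows E y) ->
  exists d C, 0 < d /\ forall y, (forall k, modulus (y k) `^ p k <= d) ->
    forall n, modulus (rowsum E y n) <= C.
Proof.
apply: (@gliding_hump _ _ (c0p p)
  (fun d y => forall k, modulus (y k) `^ p k <= d)) => //.
- move=> N y; apply: cvg_near_cst; exists N => // k /= Nk.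
  by rewrite /truncation /splice ltnNge Nk modulus0 powRp0.
- move=> d y d1 yd k; apply: (powR_le1 (p_gt0 k)); first exact: modulus_ge0.
  exact: le_trans (yd k) d1.
- move=> y N N0 Nlt hy; apply/cvgrPdist_le => e e0.
  have [i ie] := exists_half_lt e0; exists (N i) => // k /= Nk.
  have [j /andP[Nj jN]] := block_index N0 Nlt k.
  have ij : (i <= j)%N.
    rewrite leqNgt; apply/negP => ji.
    have := homo_leq leqnn (fun _ _ _ => @leq_trans _ _ _) (fun n => ltnW (Nlt n)) ji.
    by rewrite leqNgt (leq_ltn_trans Nk jN).
  have [x Qx yx] := hy j; rewrite sub0r normrN ger0_norm ?powR_ge0 // yx ?Nj //.
  apply: (le_trans (Qx k)); apply: le_trans ie.
  by rewrite ler_wiXn2l // ?invr_ge0 ?invf_le1 ?ler1n.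
Qed.

(** Necessity: the sequence [L^(-1/p_k)] is in the ball of radius [d] as soon as
    [1/L <= d].  Sufficiency: a sequence of [c_0(p)] is eventually dominated by
    [L^(-1/p_k)], hence dominated by a multiple of it. *)
Lemma c0p_bounded_rowsP : (forall y, c0p p y -> bounded_rows E y) <->
  exists2 L : nat, (0 < L)%N & exists M, forall n,
    \sum_(k < n.+1) modulus (E n k) * L%:R `^ (- (1 / p k)) <= M.
Proof.
split=> [/c0p_local_bound [d [C [d0 hC]]]|[L L0 [M hM]] y y0].
  exists (Num.truncn d^-1).+1 => //; set L := _.+1; exists C => n.
  pose c k : R := L%:R `^ (- (1 / p k)).
  have [y yc <-] := exists_aligned (E n) (fun k => powR_ge0 _ _ : 0 <= c k).
  apply: hC => k; rewrite yc /c -powRrM mulNr mul1r mulVf ?gt_eqF //.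
  rewrite powR_inv1 // invf_ple ?posrE ?ltr0n //.
  by rewrite ltW // truncnS_gt.
have L0' : 0 < L%:R :> R by rewrite ltr0n.
have cpos k : 0 < L%:R `^ (- (1 / p k)) by rewrite powR_gt0.
have iL0 : 0 < L%:R^-1 :> R by rewrite invr_gt0.
move/cvgrPdist_le: y0 => /(_ _ iL0)[N _ hN].
have [B hB] : exists B, forall k, modulus (y k) / L%:R `^ (- (1 / p k)) <= B.
  apply: (@bounded_natl _ _ 1 N) => k Nk; rewrite ler_pdivrMr // mul1r.
  have := hN k Nk; rewrite sub0r normrN ger0_norm ?powR_ge0 // => h.
  have := ler_powRV (p_gt0 k) (modulus_ge0 _) h.
  by rewrite -powR_inv1 ?ler0n // -powRrM mulN1r mul1r.
exists (B * M) => n; apply: (le_trans (modulus_rowsum _ _ _)).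
have B0 : 0 <= B by apply: le_trans (hB 0%N); rewrite divr_ge0 ?modulus_ge0 // ltW.
apply: (@le_trans _ _ (B * \sum_(k < n.+1) modulus (E n k) * L%:R `^ (- (1 / p k)))).
  rewrite mulr_sumr; apply: ler_sum => k _.
  rewrite mulrCA ler_wpM2l ?modulus_ge0 // -ler_pdivrMr //; exact: hB.
by rewrite ler_wpM2l.
Qed.

(** If [y] tends to [l] in [c(p)], the rows of [y - l] and of the constant
    sequence [l] add up to those of [y]; constants are in [c(p)] because
    [0^(p_k) = 0]. *)
Lemma cp_bounded_rowsP : (forall y, cp p y -> bounded_rows E y) <->
  (forall y, c0p p y -> bounded_rows E y) /\
  exists M, forall n, modulus (\sum_(k < n.+1) E n k) <= M.
Proof.
split=> [h|[h [M hM]] y [l yl]].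
  split=> [y y0|]; first by apply: h; exists 0; under eq_fun do rewrite subr0.
  have [|M hM] := h (fun=> 1).
    exists 1; under eq_fun do rewrite subrr modulus0 powRp0; exact: cvg_cst.
  by exists M => n; have := hM n; rewrite /rowsum; under eq_bigr do rewrite mulr1.
have [B hB] := h (fun k => y k - l) yl.
exists (B + modulus l * M) => n.
have -> : rowsum E y n = rowsum E (fun k => y k - l) n + l * \sum_(k < n.+1) E n k.
  rewrite /rowsum mulr_sumr -big_split; apply: eq_bigr => k _ /=.
  by rewrite mulrBr [l * _]mulrC subrK.
apply: (le_trans (modulusD _ _)); rewrite lerD // modulusM.
by rewrite ler_wpM2l ?modulus_ge0.
Qed.

(** The induction is on the block number [i], with the sharper bound
    [2 - 2 * 2^-i] for the sum over the first [i] blocks. *)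
Lemma lp_block_sum (y : nat -> K) (N : nat -> nat) :
  N 0%N = 0%N -> (forall i, (N i < N i.+1)%N) ->
  (forall i, exists2 x : nat -> K,
     forall n, \sum_(k < n) modulus (x k) `^ p k <= 2^-1 ^+ i &
     forall k, (N i <= k < N i.+1)%N -> y k = x k) ->
  forall n, \sum_(k < n) modulus (y k) `^ p k <= 2.
Proof.
move=> N0 Nlt hy n.
have leN i : (i <= N i)%N by elim: i => // i ih; apply: leq_ltn_trans (Nlt i).
have hS i : \sum_(0 <= k < N i) modulus (y k) `^ p k <= 2 - 2 * 2^-1 ^+ i.
  elim: i => [|i ih]; first by rewrite N0 big_geq // expr0 mulr1 subrr.
  rewrite (big_cat_nat _ (ltnW (Nlt i))) //=.
  have [x Qx yx] := hy i.
  have : \sum_(N i <= k < N i.+1) modulus (y k) `^ p k <= 2^-1 ^+ i.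
    apply: le_trans (Qx (N i.+1)).
    rewrite -(big_mkord xpredT (fun k => modulus (x k) `^ p k)).
    rewrite [leRHS](big_cat_nat _ (ltnW (Nlt i))) //= -[leLHS]add0r lerD //.
      by apply: sumr_ge0 => k _; rewrite powR_ge0.
    rewrite big_nat_cond [leRHS]big_nat_cond; apply: ler_sum => k /andP[hk _].
    by rewrite yx.
  move: ih; rewrite exprS; set a := 2^-1 ^+ i; lra.
rewrite -(big_mkord xpredT (fun k => modulus (y k) `^ p k)).
apply: (@le_trans _ _ (\sum_(0 <= k < N n) modulus (y k) `^ p k)).
  rewrite [leRHS](big_cat_nat _ (leN n)) //= lerDl.
  by apply: sumr_ge0 => k _; rewrite powR_ge0.
by apply: (le_trans (hS n)); rewrite gerBl mulr_ge0 // exprn_ge0 // invr_ge0.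
Qed.

Lemma lpP y : lp p y <-> exists M, forall n, \sum_(k < n) modulus (y k) `^ p k <= M.
Proof. by apply: eseries_lt_pinftyP => k; apply: powR_ge0. Qed.

Lemma lp_local_bound : (forall y, lp p y -> bounded_rows E y) ->
  exists d C, 0 < d /\
    forall y, (forall n, \sum_(k < n) modulus (y k) `^ p k <= d) ->
    forall n, modulus (rowsum E y n) <= C.
Proof.
apply: (@gliding_hump _ _ (lp p)
  (fun d y => forall n, \sum_(k < n) modulus (y k) `^ p k <= d)) => //.
- move=> N y; rewrite /lp /= (@eseries_finite _ _ N) ?ltry // => k Nk.
  by rewrite /truncation /splice ltnNge Nk modulus0 powRp0.
- move=> d y d1 yd k; apply: (powR_le1 (p_gt0 k)); first exact: modulus_ge0.
  apply: le_trans d1; apply: le_trans (yd k.+1); rewrite big_ord_recr /= lerDr.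
  by apply: sumr_ge0 => j _; rewrite powR_ge0.
- by move=> y N N0 Nlt hy; apply/lpP; exists 2; apply: lp_block_sum hy.
Qed.

(** Sufficiency is Young's inequality.  For necessity, let [C] bound all rows
    on the ball of radius [d], let [e_k = |e_nk| / L] with [L d > C], and let [S]
    be the sum of the [e_k^(p_k')].  If [S > d], then
    [y_k = (d/S) e_k^(p_k' - 1)] is in the ball of radius [d], because
    [(d/S)^(p_k) <= d/S] and [(p_k' - 1) p_k = p_k']; but the [n]-th row takes
    the value [L (d/S) S = L d > C] on it.  So [S <= d]. *)
Lemma lp_bounded_rowsP_gt1 : (forall k, 1 < p k) ->
  (forall y, lp p y -> bounded_rows E y) <->
  exists2 L : nat, (0 < L)%N & exists M, forall n,
    \sum_(k < n.+1) modulus (E n k * L%:R^-1) `^ (p k / (p k - 1)) <= M.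
Proof.
move=> p_gt1; pose q k := p k / (p k - 1).
have p1 k : 0 < p k - 1 by rewrite subr_gt0.
have q0 k : 0 < q k by rewrite divr_gt0.
have qE k : q k = (p k - 1)^-1 + 1.
  by rewrite /q -{1}(subrK 1 (p k)) mulrDl divff ?gt_eqF // mul1r addrC.
split=> [/lp_local_bound [d [C [d0 hC]]]|[L L0 [M hM]] y /lpP[S hS]].
  exists (Num.truncn (C / d)).+1 => //; set L := _.+1; exists d => n.
  have L0 : 0 < L%:R :> R by rewrite ltr0n.
  have CL : C < L%:R * d by rewrite -ltr_pdivrMr // truncnS_gt.
  pose e k := modulus (E n k * L%:R^-1).
  have e0 k : 0 <= e k by apply: modulus_ge0.
  rewrite -/(\sum_(k < n.+1) e k `^ q k) leNgt; apply/negP.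
  set S := \sum_(k < n.+1) e k `^ q k => dS.
  have S0 : 0 < S := lt_trans d0 dS.
  pose th := d / S.
  have th0 : 0 < th by rewrite divr_gt0.
  have th1 : th <= 1 by rewrite ler_pdivrMr // mul1r ltW.
  (* The equality case of Young's inequality, scaled into the ball; the exponent
     is [p_k' - 1]. *)
  pose c k := th * e k `^ (p k - 1)^-1.
  have c0 k : 0 <= c k by rewrite mulr_ge0 ?powR_ge0 // ltW.
  have [y yc rowE] := exists_aligned (E n) c0.
  have : modulus (rowsum E y n) <= C.
    apply: hC => m.
    apply: (@le_trans _ _ (th * \sum_(k < m) e k `^ q k)).
      rewrite mulr_sumr; apply: ler_sum => k _; rewrite yc /c.
      rewrite powRM ?powR_ge0 ?(ltW th0) // -powRrM.
      rewrite [_^-1 * _]mulrC -/(q k) ler_wpM2r ?powR_ge0 //.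
      apply: powR_ler_ge1 => //; exact: ltW.
    rewrite -[leRHS](@divfK _ S) ?gt_eqF // -/th ler_wpM2l ?(ltW th0) //.
    apply: (@sum_finite_le _ (fun k => e k `^ q k)) => k; first exact: powR_ge0.
    by move=> nk; rewrite /e hE // mul0r modulus0 powR0 // gt_eqF.
  rewrite leNgt => /negP; apply; rewrite /rowsum rowE.
  apply: (lt_le_trans CL); rewrite -[d](@divfK _ S) ?gt_eqF // -/th.
  rewrite mulrA mulr_sumr; apply: ler_sum => k _.
  have -> : modulus (E n k) = L%:R * e k.
    by rewrite /e modulusM modulusV modulus_nat mulrCA divff ?mulr1 // gt_eqF.
  rewrite /c mulrACA ler_wpM2l ?(ltW (mulr_gt0 L0 th0)) // qE.
  have [->|ek] := eqVneq (e k) 0.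
    by rewrite mul0r powR0 // gt_eqF // -qE.
  by rewrite powRD ?ek ?implybT // powRr1 // mulrC.
exists (L%:R * (S + M)) => n; apply: (le_trans (modulus_rowsum _ _ _)).
apply: (@le_trans _ _ (L%:R * (\sum_(k < n.+1) modulus (y k) `^ p k +
  \sum_(k < n.+1) modulus (E n k * L%:R^-1) `^ q k))); last first.
  by rewrite ler_wpM2l // lerD.
have L0' : 0 < L%:R :> R by rewrite ltr0n.
rewrite -big_split mulr_sumr; apply: ler_sum => k _ /=.
have {1}-> : modulus (E n k) = L%:R * modulus (E n k * L%:R^-1).
  by rewrite modulusM modulusV modulus_nat mulrCA divff ?mulr1 // gt_eqF.
rewrite -mulrA ler_wpM2l // mulrC.
have pq : (p k)^-1 + (q k)^-1 = 1.
  by rewrite /q invf_div -{1}[(p k)^-1]mul1r -mulrDl addrC subrK divff // gt_eqF.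
apply: (le_trans (conjugate_powR (modulus_ge0 _) (modulus_ge0 _) _ _ pq)) => //.
have aux (a b : R) : 0 <= a -> 1 <= b -> a / b <= a.
  by move=> a0 b1; rewrite ler_pdivrMr ?(lt_le_trans ltr01) // ler_peMr.
rewrite lerD // aux ?powR_ge0 // ?(ltW (p_gt1 k)) //.
by rewrite qE lerDr invr_ge0 ltW.
Qed.

(** Necessity tests one coordinate at a time.  Sufficiency uses that exponents
    at most 1 make [l(p)] embed in [l_1]: if [M > 0] bounds [|e_nk / L|^(p_k)] and
    [b_k = |y_k|^(p_k)] tends to 0, then [(M b_k)^(1/p_k) <= M b_k] eventually,
    hence [(M b_k)^(1/p_k) <= G b_k] for all [k], with a constant [G] that depends
    on [y] but not on the row. *)
Lemma lp_bounded_rowsP_le1 : (forall k, p k <= 1) ->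
  (forall y, lp p y -> bounded_rows E y) <->
  exists2 L : nat, (0 < L)%N & exists M, forall n k,
    modulus (E n k * L%:R^-1) `^ p k <= M.
Proof.
move=> p_le1.
split=> [/lp_local_bound [d [C [d0 hC]]]|[L L0 [M hM]] y /lpP[S hS]].
  exists (Num.truncn C).+1 => //; set L := _.+1; exists d^-1 => n k.
  have L0 : 0 < L%:R :> R by rewrite ltr0n.
  case: (ltnP n k) => [nk|kn].
    by rewrite hE // mul0r modulus0 powRp0 invr_ge0 ltW.
  pose c j := if j == k then d `^ (p k)^-1 else 0 : R.
  have c0 j : 0 <= c j by rewrite /c; case: ifP; rewrite ?powR_ge0.
  have [y yc rowE] := exists_aligned (E n) c0.
  have ck m : \sum_(j < m) modulus (y j) `^ p j <= d.
    apply: (@le_trans _ _ (\sum_(j < m) if (j : nat) == k then d else 0)).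
      apply: ler_sum => j _; rewrite yc /c; case: eqP => [->|_].
        by rewrite powRVK // ltW.
      by rewrite powRp0.
    rewrite -big_mkcond; case: (ltnP k m) => km.
      by rewrite (big_pred1 (Ordinal km)).
    rewrite big_pred0 ?ltW // => j; apply/negbTE.
    by rewrite neq_ltn (leq_trans (ltn_ord j) km).
  have := hC y ck n; rewrite /rowsum rowE -ltnS in kn *.
  rewrite (bigD1 (Ordinal kn)) //= /c eqxx => h.
  have {h} EC : modulus (E n k) * d `^ (p k)^-1 <= L%:R.
    apply: ltW; apply: le_lt_trans (truncnS_gt C); apply: le_trans h.
    by rewrite lerDl sumr_ge0 // => j _; rewrite mulr_ge0 ?modulus_ge0 ?c0.
  rewrite -[leRHS]mul1r ler_pdivlMr // -[d](powRVK (p_gt0 k) (ltW d0)).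
  rewrite -powRM ?modulus_ge0 ?powR_ge0 // -[leRHS](one_powR (p k)).
  apply: ge0_ler_powR; rewrite ?(ltW (p_gt0 k)) //.
  - by rewrite nnegrE mulr_ge0 ?modulus_ge0 ?powR_ge0.
  - by rewrite nnegrE.
  by rewrite modulusM modulusV modulus_nat mulrAC ler_pdivrMr // mul1r.
have L0' : 0 < L%:R :> R by rewrite ltr0n.
pose b k := modulus (y k) `^ p k.
pose M' := Num.max 1 M.
have M'0 : 0 < M' by rewrite lt_max ltr01.
have b0 k : 0 <= b k by apply: powR_ge0.
have b_cvg : b k @[k --> \oo] --> (0 : R).
  apply: cvg_series_cvg_0; apply: nnseries_is_cvg => //.
  by apply/lpP; exists S.
have iM0 : 0 < M'^-1 by rewrite invr_gt0.
move/cvgrPdist_le: b_cvg => /(_ _ iM0)[N _ hN].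
(* Where [b k = 0] the quotient is [0], as [0^-1 = 0]. *)
have [G hG] : exists G, forall k, (M' * b k) `^ (p k)^-1 / b k <= G.
  apply: (@bounded_natl _ _ M' N) => k Nk.
  have := hN k Nk; rewrite sub0r normrN ger0_norm // => bM.
  have [->|bk] := eqVneq (b k) 0; first by rewrite invr0 mulr0 ltW.
  have bk0 : 0 < b k by rewrite lt_neqAle eq_sym bk b0.
  rewrite ler_pdivrMr //; apply: powR_ler_ge1.
  - by rewrite mulr_ge0 // ltW.
  - by rewrite mulrC -ler_pdivlMr // mul1r.
  - by rewrite invf_ge1.
have G0 : 0 <= G by apply: le_trans (hG 0%N); rewrite divr_ge0 ?powR_ge0.
exists (L%:R * G * S) => n; apply: (le_trans (modulus_rowsum _ _ _)).
apply: (@le_trans _ _ (L%:R * G * \sum_(k < n.+1) b k)); last first.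
  by rewrite ler_wpM2l ?mulr_ge0.
rewrite mulr_sumr; apply: ler_sum => k _.
have -> : modulus (E n k) = L%:R * modulus (E n k * L%:R^-1).
  by rewrite modulusM modulusV modulus_nat mulrCA divff ?mulr1 // gt_eqF.
rewrite -!mulrA ler_wpM2l //.
have [bk|bk] := eqVneq (b k) 0.
  by move/eqP: bk; rewrite powR_eq0 => /andP[/eqP-> _]; rewrite mulr0 mulr_ge0.
have bk0 : 0 < b k by rewrite lt_neqAle eq_sym bk b0.
apply: (@le_trans _ _ ((M' * b k) `^ (p k)^-1)); last by rewrite -ler_pdivrMr.
apply: ler_powRV; rewrite ?mulr_ge0 ?modulus_ge0 //.
rewrite powRM ?modulus_ge0 // ler_wpM2r ?powR_ge0 //.
by rewrite /M' le_max hM orbT.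
Qed.

End Maddox.

(** Necessity for a given [L] is the characterization for [c_0] with constant
    exponent 1, applied to the matrix [(e_nk L^(1/p_k))]: if [z] is a null
    sequence, then [(L^(1/p_k) z_k)] is in [l_oo(p)]. *)
Lemma linf_bounded_rowsP (R : realType) (F : scalar_kind) (p : nat -> R)
    (E : nat -> nat -> scalar_field R F) :
  (forall k, 0 < p k) -> lower_triangular E ->
  (forall y, linf p y -> bounded_rows E y) <->
  forall L : nat, (0 < L)%N -> exists M, forall n,
    \sum_(k < n.+1) modulus (E n k) * L%:R `^ (1 / p k) <= M.
Proof.
move=> p_gt0 hE.
have linfP (y : nat -> scalar_field R F) :
    linf p y <-> exists M, forall k, modulus (y k) `^ p k <= M.
  by apply: fin_supP => k; apply: powR_ge0.
split=> [h L L0|h y /linfP[M hM]]; last first.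
  have [B hB] := h (Num.truncn M).+1 isT.
  exists B => n; apply: (le_trans (modulus_rowsum _ _ _)); apply: le_trans (hB n).
  apply: ler_sum => k _; rewrite ler_wpM2l ?modulus_ge0 // mul1r.
  apply: ler_powRV; rewrite ?modulus_ge0 // (le_trans (hM k)) //.
  by rewrite ltW // truncnS_gt.
pose w k : R := L%:R `^ (1 / p k).
have w0 k : 0 <= w k by apply: powR_ge0.
pose E' n k := E n k * ofreal (w k).
have hE' : lower_triangular E' by move=> n k nk; rewrite /E' hE // mul0r.
have : forall z, c0p (fun=> 1) z -> bounded_rows E' z.
  move=> z z0; have [|M hM] := h (fun k => ofreal (w k) * z k).
    apply/linfP.
    move/cvgrPdist_le: z0 => /(_ 1 ltr01)[N _ hN].
    apply: (@bounded_natl _ _ L%:R N) => k Nk.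
    have := hN k Nk; rewrite sub0r normrN powRr1 ?modulus_ge0 //.
    rewrite ger0_norm ?modulus_ge0 // => zk.
    rewrite modulusM modulus_ofreal // powRM ?modulus_ge0 //.
    rewrite /w mul1r powRVK // -[leRHS]mulr1 ler_wpM2l //.
    rewrite -[1](one_powR (p k)).
    by apply: ge0_ler_powR; rewrite ?nnegrE ?modulus_ge0 ?(ltW (p_gt0 k)) //.
  exists M => n.
  rewrite (_ : rowsum E' z n = rowsum E (fun k => ofreal (w k) * z k) n) //.
  by apply: eq_bigr => k _; rewrite mulrA.
move/(c0p_bounded_rowsP (fun=> ltr01) hE') => [L' L'0 [M hM]].
have L'0' : 0 < L'%:R :> R by rewrite ltr0n.
exists (M * L'%:R) => n; rewrite -ler_pdivrMr // (le_trans _ (hM n)) //.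
rewrite mulr_suml; apply: ler_sum => k _.
by rewrite divr1 powR_inv1 // /E' modulusM modulus_ofreal.
Qed.

(** * Convolution and the inverse of a lower triangular Toeplitz matrix *)

Section Convolution.
Context {K : fieldType}.
Implicit Types a b c s x : nat -> K.

Definition conv a b n : K := \sum_(k < n.+1) a (n - k)%N * b k.

Definition delta0 n : K := (n == 0%N)%:R.

Lemma conv_ext a b b' n : (forall k, (k <= n)%N -> b k = b' k) ->
  conv a b n = conv a b' n.
Proof. by move=> h; apply: eq_bigr => k _; rewrite h // -ltnS. Qed.

(** Convolution is the product of power series; since only finitely many
    coefficients matter, truncating to polynomials gives its algebraic laws. *)
Lemma conv_coef a b N n : (n < N)%N ->
  conv a b n = (\poly_(i < N) a i * \poly_(i < N) b i)`_n.
Proof.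
move=> nN; rewrite coefMr; apply: eq_bigr => k _.
have kN : (k < N)%N by apply: leq_ltn_trans nN; rewrite -ltnS.
by rewrite !coef_poly kN (leq_ltn_trans (leq_subr _ _) nN).
Qed.

Lemma convC a b : conv a b =1 conv b a.
Proof. by move=> n; rewrite !(@conv_coef _ _ n.+1) // mulrC. Qed.

Lemma convA a b c : conv a (conv b c) =1 conv (conv a b) c.
Proof.
move=> n; pose P (x : nat -> K) := \poly_(i < n.+1) x i.
transitivity ((P a * (P b * P c))`_n).
  rewrite coefMr; apply: eq_bigr => k _; rewrite coef_poly ltnS leq_subr.
  by rewrite (@conv_coef _ _ n.+1).
rewrite mulrA coefMr; apply: eq_bigr => k _; rewrite coef_poly ltn_ord.
by rewrite (@conv_coef _ _ n.+1) // ltnS leq_subr.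
Qed.

Lemma conv_delta0 a : conv delta0 a =1 a.
Proof.
move=> n; rewrite /conv big_ord_recr /= subnn /delta0 eqxx mul1r big1 ?add0r //.
by move=> k _; rewrite subn_eq0 leqNgt ltn_ord mul0r.
Qed.

Lemma convK a b : conv a b =1 delta0 -> forall c, conv a (conv b c) =1 c.
Proof.
move=> ab c n; rewrite convA -[RHS]conv_delta0 convC [RHS]convC.
by apply: conv_ext => k _.
Qed.

Lemma conv_binomial_inverse (u v : K) : u != 0 ->
  conv (fun m => if m == 0%N then u else if m == 1%N then v else 0)
       (fun m => (- v) ^+ m / u ^+ m.+1) =1 delta0.
Proof.
move=> u0 [|n]; rewrite /conv.
  by rewrite big_ord1 /= expr0 expr1 mul1r divff.
rewrite !big_ord_recr /= subnn subSnn /= big1 ?add0r => [|k _].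
  have un : u ^+ n != 0 by rewrite expf_neq0.
  rewrite /delta0 /= !exprS; field; exact/andP.
have kn := ltn_ord k.
rewrite (_ : (n.+1 - k == 0)%N = false); last by lia.
by rewrite (_ : (n.+1 - k == 1)%N = false) ?mul0r; last by lia.
Qed.

Definition toeplitz s N : 'M[K]_N :=
  \matrix_(i, j) (if (j <= i)%N then s (i - j)%N else 0).

Lemma det_toeplitz s N : \det (toeplitz s N) = s 0%N ^+ N.
Proof.
rewrite det_trig.
  under eq_bigr => i _ do rewrite mxE leqnn subnn.
  by rewrite prodr_const card_ord.
by apply/is_trig_mxP => i j ij; rewrite mxE leqNgt ij.
Qed.

Lemma toeplitz_conv s x N (i : 'I_N) :
  (toeplitz s N *m \col_j x j) i 0 = conv s x i.
Proof.
rewrite mxE /conv.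
rewrite (big_ord_widen N (fun k => s (i - k)%N * x k)) ?ltn_ord // [RHS]big_mkcond /=.
by apply: eq_bigr => j _; rewrite !mxE ltnS; case: ifP => _ //; rewrite mul0r.
Qed.

End Convolution.

Section Exchange.
Context {V : nmodType}.

Lemma exchange_triangle (f : nat -> nat -> V) N :
  \sum_(l < N) \sum_(j < l.+1) f l j = \sum_(j < N) \sum_(j <= l < N) f l j.
Proof.
transitivity (\sum_(l < N) \sum_(j < N) if (j <= l)%N then f l j else 0).
  apply: eq_bigr => l _; rewrite (big_ord_widen N (f l)) ?ltn_ord // big_mkcond.
  by apply: eq_bigr => j _; rewrite ltnS.
rewrite exchange_big; apply: eq_bigr => j _.
by rewrite big_geq_mkord -big_mkcond.
Qed.

End Exchange.

(** * The gamma-dual of a matrix domain *)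

Section Factors.
Context {R : realType} {F : scalar_kind}.
Local Notation K := (scalar_field R F).
Implicit Types (a r s t x y : nat -> K) (A B : nat -> nat -> K) (u v : K).

(** The coefficients of the power series inverse of [s]. *)
Definition signedD s m : K := (-1) ^+ m * Dcoef s m.

(** Cramer's rule for the system of order [n + 1] that says that [x] is inverse
    to [s]: up to the sign [(-1)^n], the last unknown is the minor of the
    Toeplitz matrix without its first row and last column, divided by the
    determinant [s_0^(n+1)], and this minor is the determinant in [Dcoef]. *)
Lemma signedD_unique s x n : s 0%N != 0 ->
  (forall i, (i <= n)%N -> conv s x i = delta0 i) -> x n = signedD s n.
Proof.
move=> s0 hx; pose T := toeplitz s n.+1; pose X : 'cV[K]_n.+1 := \col_j x j.
have TX : T *m X = \col_j delta0 j.
  by apply/matrixP => i j; rewrite ord1 toeplitz_conv hx ?mxE // -ltnS.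
have : \det T *: X = \adj T *m \col_j delta0 j.
  by rewrite -TX mulmxA mul_adj_mx mul_scalar_mx.
move/matrixP/(_ ord_max 0); rewrite !mxE det_toeplitz.
rewrite big_ord_recl big1 => [|i _]; last by rewrite !mxE /delta0 /= mulr0.
rewrite !mxE /delta0 /= mulr1 addr0 /cofactor add0n => h.
rewrite /signedD /Dcoef mulrCA.
set D := \det _ in h; set D' := \det _.
have -> : D' = D.
  congr (\det _); apply/matrixP => i j; rewrite !mxE.
  by rewrite lift0 lift_max.
by rewrite -[in RHS]h mulKf // expf_neq0.
Qed.

(** Solving the Toeplitz system of order [n + 1] gives an inverse of [s] up to
    index [n]; uniqueness at each lower order identifies all its entries. *)
Lemma conv_signedD s : s 0%N != 0 -> conv s (signedD s) =1 delta0.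
Proof.
move=> s0 n; pose T := toeplitz s n.+1.
pose X : 'cV[K]_n.+1 := invmx T *m \col_j delta0 j.
pose x k := X (inord k) 0.
have Tu : T \in unitmx by rewrite unitmxE det_toeplitz unitfE expf_neq0.
have hx i : (i <= n)%N -> conv s x i = delta0 i.
  rewrite -ltnS => ni.
  rewrite -(toeplitz_conv s x (Ordinal ni)).
  rewrite (_ : \col_j x j = X) ?mulKVmx ?mxE //.
  by apply/colP => j; rewrite mxE /x inord_val.
rewrite -hx //; apply: conv_ext => k kn; apply/esym/signedD_unique => // i ik.
by apply: hx; apply: leq_trans kn.
Qed.

Lemma imx_app_lower A x n : lower_triangular A -> imx_app A x n = rowsum A x n.
Proof.
by move=> hA; apply: infsum_finite => k nk; rewrite hA // mul0r.
Qed.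

Lemma imx_app_mul A B x n : lower_triangular A -> lower_triangular B ->
  imx_app (imx_mul A B) x n = rowsum A (rowsum B x) n.
Proof.
move=> hA hB.
have ABE i k : imx_mul A B i k = \sum_(j < i.+1) A i j * B j k.
  by apply: infsum_finite => j ij; rewrite hA // mul0r.
rewrite imx_app_lower => [|i k ik]; last first.
  by rewrite ABE big1 // => j _; rewrite hB ?mulr0 // (leq_ltn_trans _ ik) // -ltnS.
rewrite /rowsum; under eq_bigr => k _ do rewrite ABE mulr_suml.
rewrite exchange_big; apply: eq_bigr => j _ /=.
under eq_bigr => k _ do rewrite -mulrA.
rewrite -mulr_sumr; congr (_ * _).
rewrite -(@infsum_finite _ _ (fun k => B j k * x k) n.+1); last first.
  by move=> k nk; rewrite hB ?mul0r // (leq_trans (ltn_ord j)).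
by apply: infsum_finite => k jk; rewrite hB ?mul0r.
Qed.

Lemma imx_app_matAB r s t u v x n :
  imx_app (matAB r s t u v) x n =
  conv s (fun j => t j * conv (fun m => if m == 0%N then u else
            if m == 1%N then v else 0) x j) n / r n.
Proof.
rewrite imx_app_mul; last 2 first.
- by move=> i k ik; rewrite /matA leqNgt ik.
- by move=> i k ik; rewrite /matB gtn_eqF // gtn_eqF // ltnW.
rewrite /rowsum /conv mulr_suml; apply: eq_bigr => j _.
rewrite /matA -ltnS ltn_ord; set z := \sum_(k < _) _; set z' := \sum_(k < _) _.
have -> : z = z'.
  apply: eq_bigr => k _; congr (_ * _); have kj := ltn_ord k.
  rewrite /matB (_ : (j - k == 0)%N = (k == j :> nat)); last by lia.
  by rewrite (_ : (j - k == 1)%N = (k.+1 == j :> nat)); last by lia.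
ring.
Qed.

(** The inverse of [A(r,s,t;B)]: invert the Toeplitz factor of [s] between the two
    diagonal factors, then that of [B]. *)
Definition solution r s t u v y : nat -> K :=
  conv (fun m => (- v) ^+ m / u ^+ m.+1)
    (fun j => conv (signedD s) (fun k => r k * y k) j / t j).

Lemma imx_app_solution r s t u v y :
  (forall n, r n != 0) -> (forall n, t n != 0) -> s 0%N != 0 -> u != 0 ->
  imx_app (matAB r s t u v) (solution r s t u v y) = y.
Proof.
move=> r0 t0 s0 u0; apply/funext => n; rewrite imx_app_matAB.
rewrite (@conv_ext _ _ _ (conv (signedD s) (fun k => r k * y k))) => [|k _].
  by rewrite (convK (conv_signedD s0)) mulrC mulKf.
by rewrite (convK (conv_binomial_inverse _ u0)) mulrC divfK.
Qed.

Lemma solution_imx_app r s t u v x :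
  (forall n, r n != 0) -> (forall n, t n != 0) -> s 0%N != 0 -> u != 0 ->
  solution r s t u v (imx_app (matAB r s t u v) x) = x.
Proof.
move=> r0 t0 s0 u0; apply/funext => n; rewrite /solution.
pose b m := if m == 0%N then u else if m == 1%N then v else 0.
rewrite (@conv_ext _ _ _ (conv b x)) => [|j _].
  apply: convK => m; rewrite convC; exact: conv_binomial_inverse.
rewrite (@conv_ext _ _ _ (conv s (fun j => t j * conv b x j))) => [|k _].
  rewrite convK => [|m]; first by rewrite mulrC mulKf.
  by rewrite convC; apply: conv_signedD.
by rewrite imx_app_matAB mulrC divfK.
Qed.

Lemma matE_lower r s t u v a : lower_triangular (matE r s t u v a).
Proof. by move=> n k nk; rewrite /matE leqNgt nk. Qed.

(** The terms [j = k] and [j = k + 1] of this sum, the former split at [l = k],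
    make up the first two parts of the defining expression. *)
Lemma matE_sum r s t u v a n k : (k <= n)%N ->
  matE r s t u v a n k = r k * \sum_(k <= j < n.+1) signedD s (j - k) / t j *
    \sum_(j <= l < n.+1) (- v) ^+ (l - j) / u ^+ (l - j).+1 * a l.
Proof.
move=> kn; rewrite /matE kn; congr (_ * _).
have D0 : signedD s 0 = (s 0%N)^-1.
  by rewrite /signedD /Dcoef det_mx00 expr0 expr1 mul1r mulr1.
rewrite [RHS]big_ltn ?ltnS // subnn D0 [X in _ / _ * X]big_ltn ?ltnS //.
rewrite subnn expr0 expr1 [X in _ + X + _]big_ltn //.
rewrite [X in _ + (_ + X) + _]big_ltn // [X in _ + (_ + (_ + X)) + _]big_geq //.
rewrite addr0 subnn subSnn.
have D0' : Dcoef s 0 = (s 0%N)^-1 by rewrite -D0 /signedD expr0 mul1r.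
rewrite D0' expr0 mul1r.
have assoc j : (-1) ^+ (j - k) * (Dcoef s (j - k) / t j) = signedD s (j - k) / t j.
  by rewrite mulrA.
under [X in _ + X = _]eq_bigr => j _ do rewrite assoc.
move: kn; rewrite leq_eqVlt => /predU1P[->|kn].
  by rewrite !big_geq // !mulr0 !addr0 invfM; ring.
rewrite [X in _ = _ + X]big_ltn ?ltnS // subSnn.
have -> : signedD s 1 / t k.+1 = -1 * (Dcoef s 1 / t k.+1).
  by rewrite mulrA /signedD expr1.
rewrite invfM; ring.
Qed.

(** Interchanging the two convolutions in turn with the outer sum moves the
    inverse matrix from [y] to [a]; what [y_k] gets multiplied by is [e_nk]. *)
Lemma sum_solution r s t u v a y n :
  \sum_(l < n.+1) a l * solution r s t u v y l =
  rowsum (matE r s t u v a) y n.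
Proof.
pose z j := conv (signedD s) (fun k => r k * y k) j / t j.
pose U m := (- v) ^+ m / u ^+ m.+1.
pose G j := \sum_(j <= l < n.+1) U (l - j)%N * a l.
transitivity (\sum_(l < n.+1) \sum_(j < l.+1) a l * (U (l - j)%N * z j)).
  by apply: eq_bigr => l _; rewrite -mulr_sumr.
rewrite (exchange_triangle (fun l j => a l * (U (l - j)%N * z j))).
transitivity (\sum_(j < n.+1) \sum_(k < j.+1)
    signedD s (j - k) / t j * G j * (r k * y k)).
  apply: eq_bigr => j _.
  transitivity (G j * z j).
    by rewrite mulr_suml; apply: eq_bigr => l _; ring.
  by rewrite /z /conv [_ / t j]mulr_suml mulr_sumr; apply: eq_bigr => k _; ring.
rewrite (exchange_triangle
  (fun j k => signedD s (j - k)%N / t j * G j * (r k * y k))).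
apply: eq_bigr => k _.
rewrite matE_sum; last by rewrite -ltnS.
by rewrite -mulr_suml -/G; ring.
Qed.

(** As [x] runs through the domain, [y = A(r,s,t;B) x] runs through all of [X],
    because [solution] is a right inverse; it being a left inverse expresses the
    partial sums of [(a_n x_n)] by [y] for every such [x]. *)
Lemma gamma_dual_mx_domain (X : set (nat -> K)) r s t u v :
  (forall n, r n != 0) -> (forall n, t n != 0) -> s 0%N != 0 -> u != 0 ->
  gamma_dual (mx_domain X r s t u v) =
  [set a | forall y, X y -> bounded_rows (matE r s t u v a) y].
Proof.
move=> r0 t0 s0 u0; apply/seteqP.
have bsP (z : nat -> K) : bs z <-> exists M, forall n, modulus (series z n) <= M.
  by apply: fin_supP => n; apply: modulus_ge0.
have serE a y n : series (fun n => a n * solution r s t u v y n) n.+1 =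
    rowsum (matE r s t u v a) y n.
  by rewrite -sum_solution /series /= big_mkord.
split=> a ha y.
  move=> Xy; have /ha/bsP[M hM] : mx_domain X r s t u v (solution r s t u v y).
    by rewrite /mx_domain /= imx_app_solution.
  by exists M => n; rewrite -serE.
move=> /ha[M hM]; apply/bsP; exists M => -[|n].
  by rewrite /series /= big_geq // modulus0 (le_trans (modulus_ge0 _) (hM 0%N)).
by have := hM n; rewrite -serE solution_imx_app.
Qed.

End Factors.

(** * The gamma-duals *)

Theorem theorem4p5 (R : realType) (F : scalar_kind)
    (r s t : nat -> scalar_field R F) (u v : scalar_field R F) (p : nat -> R)
    (hr : forall n, r n != 0) (ht : forall n, t n != 0) (hs : s 0%N != 0)
    (hu : u != 0) (hv : v != 0)
    (hp : forall k, 0 < p k) (hH : has_ubound (range p)) :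
  (((forall k, 1 < p k) ->
      gamma_dual (mx_domain (lp p) r s t u v) = Gamma5 r s t u v p) /\
   ((forall k, p k <= 1) ->
      gamma_dual (mx_domain (lp p) r s t u v) = Gamma4 r s t u v p)) /\
  (gamma_dual (mx_domain (c0p p) r s t u v) = Gamma1 r s t u v p /\
   gamma_dual (mx_domain (cp p) r s t u v) =
     Gamma1 r s t u v p `&` Gamma2 r s t u v /\
   gamma_dual (mx_domain (linf p) r s t u v) = Gamma3 r s t u v p).
Proof.
have hE := @matE_lower R F r s t u v.
have rowsP a (L : nat) (q : nat -> R) :
    fin_sup_sum (fun n k => modulus (matE r s t u v a n k) * L%:R `^ q k) <->
    exists M, forall n,
      \sum_(k < n.+1) modulus (matE r s t u v a n k) * L%:R `^ q k <= M.
  apply: fin_sup_sumP => n k; first by rewrite mulr_ge0 ?modulus_ge0 ?powR_ge0.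
  by move=> nk; rewrite hE // modulus0 mul0r.
have dualE X a : gamma_dual (mx_domain X r s t u v) a <->
    forall y, X y -> bounded_rows (matE r s t u v a) y.
  by rewrite gamma_dual_mx_domain.
have Gamma1E a : Gamma1 r s t u v p a <->
    forall y, c0p p y -> bounded_rows (matE r s t u v a) y.
  rewrite c0p_bounded_rowsP //.
  by split=> -[L L0 hL]; exists L => //; exact/(rowsP a L (fun k => - (1 / p k))).
split; split; last split.
- move=> p_gt1; apply/seteqP.
  have q0 k : p k / (p k - 1) != 0.
    by rewrite gt_eqF // divr_gt0 // subr_gt0.
  have rows5 a (L : nat) :
      fin_sup_sum (fun n k =>
        modulus (matE r s t u v a n k * L%:R^-1) `^ (p k / (p k - 1))) <->
      exists M, forall n, \sum_(k < n.+1)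
        modulus (matE r s t u v a n k * L%:R^-1) `^ (p k / (p k - 1)) <= M.
    apply: fin_sup_sumP => n k; first exact: powR_ge0.
    by move=> nk; rewrite hE // mul0r modulus0 powR0.
  split=> a.
    move=> /dualE/(lp_bounded_rowsP_gt1 hp (hE a) p_gt1)[L L0 hL].
    by exists L => //; apply/rows5.
  move=> [L L0 /rows5 hL]; apply/dualE/(lp_bounded_rowsP_gt1 hp (hE a) p_gt1).
  by exists L.
- move=> p_le1; apply/seteqP.
  have rows4 a (L : nat) := @ereal_sup_sup_finP R
    (fun n k => modulus (matE r s t u v a n k * L%:R^-1) `^ p k)
    (fun n k => powR_ge0 _ _).
  split=> a.
    move=> /dualE/(lp_bounded_rowsP_le1 hp (hE a) p_le1)[L L0 hL].
    by exists L => //; apply/rows4.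
  move=> [L L0 /rows4 hL]; apply/dualE/(lp_bounded_rowsP_le1 hp (hE a) p_le1).
  by exists L.
- by apply/seteqP; split=> a; [move/dualE/Gamma1E|move/Gamma1E/dualE].
- have Gamma2E a : Gamma2 r s t u v a <->
      exists M, forall n, modulus (\sum_(k < n.+1) matE r s t u v a n k) <= M.
    rewrite /Gamma2 /= fin_supP => [|n]; last exact: modulus_ge0.
    have rowE n : infsum (matE r s t u v a n) =
        \sum_(k < n.+1) matE r s t u v a n k by apply: infsum_finite => k; exact: hE.
    by split=> -[M hM]; exists M => n; have := hM n; rewrite rowE.
  apply/seteqP; split=> a.
    by move=> /dualE/(cp_bounded_rowsP _ hp)[/Gamma1E ? /Gamma2E].
  by move=> [/Gamma1E h1 /Gamma2E h2]; apply/dualE/(cp_bounded_rowsP _ hp).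
- apply/seteqP; split=> a.
    move=> /dualE/(linf_bounded_rowsP hp (hE a)) h L /h hL.
    exact/(rowsP a L (fun k => 1 / p k)).
  move=> h; apply/dualE/(linf_bounded_rowsP hp (hE a)) => L L0.
  exact/(rowsP a L (fun k => 1 / p k))/h.
Qed.
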